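(* Let $\mathbb{F}$ be a field of characteristic different from $2$, let $V$ be a finite-dimensional vector space over $\mathbb{F}$, and let $b$ be a symplectic form on $V$. Then every element of $\mathrm{Sp}(b)$ is the product of three $U_2$-elements (unipotent elements of index $2$) of $\mathrm{Sp}(b)$.
   Context: A symplectic form is a non-degenerate bilinear form $b$ with $b(y,x)=-b(x,y)$ for all $x,y$. $\mathrm{Sp}(b)$ is the group of all automorphisms $u$ of $V$ with $b(u(x),u(y))=b(x,y)$ for all $x,y \in V$. An element $u\in \mathrm{Sp}(b)$ is a $U_2$-element (unipotent of index $2$) when $(u-\mathrm{id}_V)^2=0$ (in particular the identity is a $U_2$-element). *)

(* Defs.v *)
From mathcomp Require Import all_boot all_algebra.

Set Implicit Arguments.
Unset Strict Implicit.
Unset Printing Implicit Defensive.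

Import GRing.Theory.
Local Open Scope ring_scope.

Definition in_Sp (F : fieldType) (V : vectType F) (b : {skew_symmetric V})
    (u : 'End(V)) : Prop :=
  bijective u /\ isometry b b u.

Definition U2_element (F : fieldType) (V : vectType F)
    (b : {skew_symmetric V}) (u : 'End(V)) : Prop :=
  in_Sp b u /\ ((u - \1) \o (u - \1) = 0)%VF.

(* Main.v *)
Require Import Defs.
From HB Require Import structures.
From mathcomp Require Import all_boot all_algebra.
From mathcomp Require Import ring.
From Stdlib Require Import Classical.

Set Implicit Arguments.
Unset Strict Implicit.
Unset Printing Implicit Defensive.

Import GRing.Theory.
Local Open Scope ring_scope.

(** Every isometry [u] of a symplectic form [b] is a product of three
    unipotents of index 2.  The idea is to correct [u] by one such element so
    that a Lagrangian witnesses that the corrected isometry is a product of two.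

    Let [L] be a Lagrangian and [v] an isometry with [L :&: v L = 0], and suppose
    that [(x, y) |-> b x (v y)] is symmetric on [L].  In coordinates adapted to
    [L] and a complementary Lagrangian, the lower left block of [v] is an
    invertible symmetric matrix [T], so that [v] is a product of unitriangular
    symplectic matrices: upper with block [S], lower with block [T], upper with
    block [S'].  Conjugating the last factor across gives two unipotents of
    index 2.  [product_of_two_U2] is this argument free of coordinates.

    For an arbitrary [u], choose Lagrangians [L] and [N] with [N] transverse to
    both [L] and [u L] ([exists_lagrangian], [lagrangian_transversal]).  Then
    [A], the endomorphism of [L] that applies [u] and projects along [N], is
    invertible.  Composing [u] with [1 + n], where [n] kills [N] and maps [L]
    to [N], adds to [b x (u y)] the term [q x (A y)], where [q] is the form on
    [L] that defines [n], and [q] can be any symmetric form.  Since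
    [(x, y) |-> b x (u (A^-1 y))] is itself symmetric, one can choose [q] so
    that [b x (v y) = f x (A y)] for any prescribed symmetric form [f].  It
    remains to find [f] nondegenerate on [L] such that [f x (A y)] is symmetric,
    that is, such that [A] is self-adjoint for [f].  By a theorem of Taussky and
    Zassenhaus this is possible for every endomorphism over every field
    ([stable_symmetrizable]).

    The Taussky-Zassenhaus theorem is proved by splitting the space into stable
    summands.  Coprime factors of an annihilating polynomial split the space, so
    one may assume that a power [pi ^+ k] of an irreducible polynomial
    annihilates it.  Take [x] and a functional [phi] such that
    [phi (pi(A)^(k-1) x)] is nonzero.  The Hankel matrix of the scalars
    [phi (A^(i+j) x)] is then invertible, so the cyclic subspace generated by
    [x] has as a stable complement the vectors [y] with [phi (A^i y) = 0] for all
    [i], and on that cyclic subspace the inverse Hankel matrix provides the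
    form ([hankel_split]). *)

(** * Polynomials modulo a power of an irreducible *)

Section Polynomials.
Variable F : fieldType.
Implicit Types p q : {poly F}.

(** Excluded middle enters here: irreducibility is undecidable over a general
    field. *)
Lemma irreducible_factor p : (1 < size p)%N ->
  exists2 pi, irreducible_poly pi & pi %| p.
Proof.
elim: {p}(size p) {-2}p (leqnn (size p)) => [|n IHn] p; first by case: (size p).
move=> le_p_n p_gt1; have [p_irr|] := classic (irreducible_poly p); first by exists p.
move=> p_red; apply: NNPP => noirr; apply: p_red; split=> // q q_n1 q_p.
have p0 : p != 0 by rewrite -size_poly_gt0 ltnW.
have q0 : q != 0 by apply: contraNneq p0 => q0; move: q_p; rewrite q0 dvd0p.
have q_gt1 : (1 < size q)%N by rewrite ltn_neqAle eq_sym q_n1 size_poly_gt0.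
rewrite -dvdp_size_eqp // eqn_leq dvdp_leq //= leqNgt; apply/negP => lt_qp.
case: noirr; have [pi pi_irr pi_q] := IHn q (leq_trans lt_qp le_p_n) q_gt1.
by exists pi => //; apply: dvdp_trans q_p.
Qed.

Lemma split_power (pi p : {poly F}) : (1 < size pi)%N -> p != 0 ->
  exists k m, p = pi ^+ k * m /\ ~~ (pi %| m).
Proof.
move=> pi_gt1; elim: {p}(size p) {-2}p (leqnn (size p)) => [|n IHn] p.
  by rewrite leqn0 size_poly_eq0 => ->.
move=> le_pn p0; have [/dvdpP[q def_p]|] := boolP (pi %| p); last first.
  by exists 0, p; rewrite mul1r.
have q0 : q != 0 by apply: contraNneq p0 => q0; rewrite def_p q0 mul0r.
have pi0 : pi != 0 by rewrite -size_poly_gt0 ltnW.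
have [||k [m [def_q pi_m]]] := IHn q => //.
  move: le_pn; rewrite def_p size_mul // => le_qpi.
  rewrite -ltnS; apply: leq_trans le_qpi.
  by rewrite -subn1 -addnBA ?(ltnW pi_gt1) // -addn1 leq_add2l subn_gt0.
by exists k.+1, m; rewrite def_p def_q mulrC exprS mulrA.
Qed.

(** The ideal generated by [pi ^+ k.-1] is the smallest nonzero ideal modulo
    [pi ^+ k]: once the factors [pi] of [p] are removed, what remains is
    invertible modulo [pi] by Bezout.  A functional that does not vanish on
    this ideal therefore detects every nonzero element. *)
Lemma mod_primary_socle (pi : {poly F}) k p :
    irreducible_poly pi -> ~~ (pi ^+ k %| p) ->
  exists r, pi ^+ k %| p * r - pi ^+ k.-1.
Proof.
move=> pi_irr; elim: k p => [|k IHk] p; first by rewrite expr0 dvd1p.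
have [/dvdpP[q ->] | pi_p _] := boolP (pi %| p); last first.
  have /Bezout_eq1_coprimepP[[u v] /= uv1] : coprimep pi p.
    by rewrite irreducible_poly_coprime.
  exists (v * pi ^+ k); apply/dvdpP; exists (- u).
  rewrite -[X in _ - X]mul1r -uv1 exprS; ring.
have pi0 := irredp_neq0 pi_irr.
rewrite exprSr (dvdp_mul2r _ _ pi0); case: k IHk => [|k] IHk.
  by rewrite expr0 dvd1p.
move/IHk=> [r] /=; rewrite -(dvdp_mul2r _ _ pi0) mulrBl -!exprSr => dvr.
by exists r; rewrite mulrAC.
Qed.
End Polynomials.

(** * Self-adjointness on stable subspaces *)

Section SelfAdjoint.
Variables (F : fieldType) (V : vectType F).
Implicit Types (A : 'End(V)) (U W : {vspace V}).

(** The form [f] lives on the whole space but only its restriction to [U] is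
    constrained by [A]; this lets the induction run over subspaces of one fixed
    space. *)
Definition symmetrizable_on A U :=
  exists f : V -> V -> F,
    [/\ forall x, scalar (f x), forall x y, f x y = f y x,
        {in U &, forall x y, f (A x) y = f x (A y)}
      & forall x, x \in U -> {in U, forall y, f x y = 0} -> x = 0].

(** The two forms are pulled back along the projections and added; the
    projections commute with [A] because both summands are stable. *)
Lemma symmetrizable_direct_sum A U U1 U2 :
    (A @: U1 <= U1)%VS -> (A @: U2 <= U2)%VS ->
    (U1 :&: U2 = 0)%VS -> (U1 + U2)%VS = U ->
  symmetrizable_on A U1 -> symmetrizable_on A U2 -> symmetrizable_on A U.
Proof.
move=> stU1 stU2 dxU defU [f1 [lf1 sf1 af1 nf1]] [f2 [lf2 sf2 af2 nf2]].
pose p1 := daddv_pi U1 U2; pose p2 := daddv_pi U2 U1.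
have dxU' : (U2 :&: U1 = 0)%VS by rewrite capvC.
have p1U x : p1 x \in U1 by apply: memv_pi.
have p2U x : p2 x \in U2 by apply: memv_pi.
have pD x : x \in U -> p1 x + p2 x = x.
  by move=> xU; apply: daddv_pi_add; rewrite ?defU.
have p1_1 x : x \in U1 -> p1 x = x by apply: daddv_pi_id.
have p2_2 x : x \in U2 -> p2 x = x by apply: daddv_pi_id.
have p12 x : x \in U2 -> p1 x = 0.
  move=> xU; apply: (addIr (p2 x)); rewrite pD ?add0r ?p2_2 //.
  by rewrite -defU (subvP (addvSr _ _)).
have p21 x : x \in U1 -> p2 x = 0.
  move=> xU; apply: (addrI (p1 x)); rewrite pD ?addr0 ?p1_1 //.
  by rewrite -defU (subvP (addvSl _ _)).
have AU1 x : x \in U1 -> A x \in U1 by move=> xU; apply/(subvP stU1)/memv_img.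
have AU2 x : x \in U2 -> A x \in U2 by move=> xU; apply/(subvP stU2)/memv_img.
have p1A x : x \in U -> p1 (A x) = A (p1 x).
  by move=> /pD {1}<-; rewrite !linearD /= (p1_1 (A _)) ?(p12 (A _)) ?addr0; auto.
have p2A x : x \in U -> p2 (A x) = A (p2 x).
  by move=> /pD {1}<-; rewrite !linearD /= (p21 (A _)) ?(p2_2 (A _)) ?add0r; auto.
have f10 x : f1 x 0 = 0 by have := lf1 x (-1) 0 0; rewrite scaler0 addr0 mulN1r addNr.
have f20 x : f2 x 0 = 0 by have := lf2 x (-1) 0 0; rewrite scaler0 addr0 mulN1r addNr.
exists (fun x y => f1 (p1 x) (p1 y) + f2 (p2 x) (p2 y)); split.
- by move=> x a y z; rewrite !linearP lf1 lf2 mulrDr addrACA.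
- by move=> x y; rewrite sf1 sf2.
- by move=> x y xU yU; rewrite !p1A ?p2A // af1 ?af2.
move=> x xU fx0; have p1x : p1 x = 0.
  apply: nf1 => // y yU1; have yU : y \in U by rewrite -defU (subvP (addvSl _ _)).
  by have := fx0 y yU; rewrite /= (p21 y) // (p1_1 y) // f20 addr0.
have p2x : p2 x = 0.
  apply: nf2 => // y yU2; have yU : y \in U by rewrite -defU (subvP (addvSr _ _)).
  by have := fx0 y yU; rewrite /= (p12 y) // (p2_2 y) // f10 add0r.
by rewrite -(pD x xU) p1x p2x addr0.
Qed.

Lemma symmetrizable0 A : symmetrizable_on A 0%VS.
Proof.
exists (fun _ _ => 0); split=> // [x a y z|x].
  by rewrite mulr0 addr0.
by rewrite memv0 => /eqP.
Qed.

(** * Polynomials in an endomorphism *)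

Section Eval.
Hypothesis V_proper : (0 < dim V)%N.
Variable A : 'End(V).

(** The value [p(A)], computed in the algebra of endomorphisms, which is a
    nontrivial ring only when the space is nonzero. *)
Definition peval (p : {poly F}) : 'End(V) :=
  horner_alg (A : lfun_algType V_proper) p.

Lemma pevalX : peval 'X = A.
Proof. exact: (@horner_algX F (lfun_algType V_proper) A). Qed.

Lemma peval1 x : peval 1 x = x.
Proof. by rewrite /peval rmorph1 id_lfunE. Qed.

Lemma pevalM p q x : peval (p * q) x = peval p (peval q x).
Proof. by rewrite mulrC /peval rmorphM /= -comp_lfunE. Qed.

Lemma peval0 x : peval 0 x = 0.
Proof. by rewrite /peval rmorph0 zero_lfunE. Qed.

Lemma pevalD p q x : peval (p + q) x = peval p x + peval q x.
Proof. by rewrite /peval rmorphD add_lfunE. Qed.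

Lemma pevalZ a p x : peval (a *: p) x = a *: peval p x.
Proof. by rewrite /peval linearZ /= mulr_algl; exact: (scale_lfunE a (peval p) x). Qed.

Lemma peval_is_linear : linear peval.
Proof.
by move=> a p q; apply/lfunP=> x; rewrite pevalD pevalZ add_lfunE scale_lfunE.
Qed.

HB.instance Definition _ :=
  GRing.isLinear.Build F {poly F} 'End(V) _ peval peval_is_linear.

Lemma pevalC p q x : peval p (peval q x) = peval q (peval p x).
Proof. by rewrite -!pevalM mulrC. Qed.

Lemma peval_comm p x : peval p (A x) = A (peval p x).
Proof. by rewrite -pevalX pevalC. Qed.

Lemma peval_stable U p : (A @: U <= U)%VS -> (peval p @: U <= U)%VS.
Proof.
move=> stU; apply/subvP => _ /memv_imgP[x xU ->].
elim/poly_ind: p => [|p c IHp]; first by rewrite peval0 mem0v.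
rewrite pevalD memvD //.
  by rewrite mulrC pevalM pevalX; apply/(subvP stU)/memv_img.
by rewrite -alg_polyC pevalZ peval1 memvZ.
Qed.

(** Evaluation at [A] maps polynomials of size at most [D.+1] linearly to a
    space of dimension [D], so it has a nonzero kernel. *)
Lemma annihilating_poly : exists2 p, p != 0 & forall x, peval p x = 0.
Proof.
pose D := \dim {:'End(V)}.
pose h := linfun (peval \o rVpoly : 'rV[F]_D.+1 -> 'End(V)).
have : lker h != 0%VS.
  apply/negP=> /eqP ker0; have := limg_ker_dim h fullv.
  rewrite capfv ker0 dimv0 add0n dimvf => dim_im.
  by have := dimvS (subvf (limg h)); rewrite dim_im /dim /= mul1n ltnn.
rewrite -vpick0; set a := vpick _ => a0.
have : h a = 0 by apply/eqP; rewrite -memv_ker memv_pick.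
rewrite lfunE /= => ha.
exists (rVpoly a); last by move=> x; rewrite ha lfunE.
by apply: contraNneq a0 => a0; rewrite -(rVpolyK a) a0 linear0.
Qed.

Lemma peval_mod m p x : peval m x = 0 -> peval (p %% m) x = peval p x.
Proof.
by move=> mx0; rewrite {2}(divp_eq p m) pevalD pevalM mx0 linear0 add0r.
Qed.

Lemma exists_functional (x : V) : x != 0 ->
  exists phi : {scalar V}, phi x != 0.
Proof.
move=> x0; pose e := vbasis {:V}.
have /existsP[i xi0] : [exists i, coord e i x != 0].
  apply: contraNT x0; rewrite negb_exists => /forallP xi0.
  rewrite (coord_vbasis (memvf x)) big1 // => i _.
  by have := xi0 i; rewrite negbK => /eqP->; rewrite scale0r.
by exists (coord e i).
Qed.

(** * Splitting off a cyclic subspace *)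

Section Hankel.
Variables (pi : {poly F}) (k : nat) (U : {vspace V}) (x : V) (phi : {scalar V}).
Hypotheses (pi_irr : irreducible_poly pi) (stU : (A @: U <= U)%VS).
Hypotheses (mU : {in U, forall y, peval (pi ^+ k) y = 0}) (xU : x \in U).
Hypothesis (phix : phi (peval (pi ^+ k.-1) x) != 0).

(** Rows of length [d] stand for polynomials modulo [pi ^+ k], so that [hankel]
    is the matrix of the linear map [moments \o orbit]. *)
Let d := (size (pi ^+ k)).-1.
Let orbit (a : 'rV[F]_d) := peval (rVpoly a) x.
Let moments y : 'rV[F]_d := \row_i phi (peval 'X^i y).
Let hankel : 'M[F]_d := \matrix_(i, j) phi (peval 'X^(i + j) x).

Let size_m : size (pi ^+ k) = d.+1.
Proof. by rewrite prednK // size_poly_gt0 expf_neq0 // irredp_neq0. Qed.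

Let size_mod (p : {poly F}) : (size (p %% pi ^+ k)%R <= d)%N.
Proof. by rewrite -ltnS -size_m ltn_modp expf_neq0 // irredp_neq0. Qed.

Let pevalU p y : y \in U -> peval p y \in U.
Proof. by move=> yU; apply/(subvP (peval_stable p stU))/memv_img. Qed.

Let orbitU a : orbit a \in U.
Proof. exact: pevalU. Qed.

Let orbit_lin : linear orbit.
Proof. by move=> c a b; rewrite /orbit linearP /= pevalD pevalZ. Qed.

Let moments_lin : linear moments.
Proof. by move=> c y z; apply/rowP=> i; rewrite !mxE !linearP. Qed.

Let phi_rVpoly (a : 'rV[F]_d) y :
  phi (peval (rVpoly a) y) = \sum_i a 0 i * moments y 0 i.
Proof.
have -> : rVpoly a = \sum_(i < d) a 0 i *: 'X^i.
  rewrite [rVpoly a]poly_def; apply: eq_bigr => i _.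
  by rewrite -{1}coef_rVpoly_ord coef_rVpoly.
have -> : peval (\sum_(i < d) a 0 i *: 'X^i) y = \sum_(i < d) a 0 i *: peval 'X^i y.
  elim/big_rec2: _ => [|i u v _ <-]; first exact: peval0.
  by rewrite pevalD pevalZ.
by rewrite linear_sum; apply: eq_bigr => i _; rewrite linearZ mxE.
Qed.

(** The first [d] moments determine all of them, because [pi ^+ k] has degree
    [d] and annihilates [U]. *)
Let moments0 y p : y \in U -> moments y = 0 -> phi (peval p y) = 0.
Proof.
move=> yU y0; rewrite -(peval_mod _ (mU yU)) -(poly_rV_K (size_mod p)).
by rewrite phi_rVpoly y0 big1 // => i _; rewrite !mxE mulr0.
Qed.

Let moments_orbit a : moments (orbit a) = a *m hankel.
Proof.
apply/rowP=> i; rewrite !mxE /orbit pevalC phi_rVpoly.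
by apply: eq_bigr => j _; rewrite !mxE -pevalM exprD.
Qed.

(** If [a] is nonzero, some multiple of it is [pi ^+ k.-1] modulo [pi ^+ k], and
    [phi] does not vanish on the corresponding vector. *)
Let orbit_inj a : moments (orbit a) = 0 -> a = 0.
Proof.
move=> a0; apply/eqP/idPn => nza; have dv : ~~ (pi ^+ k %| rVpoly a).
  apply: contraNN nza => /dvdp_leq le_size; apply/eqP.
  rewrite -(rVpolyK a) (_ : rVpoly a = 0) ?linear0 //; apply/eqP/idPn=> /le_size.
  by rewrite size_m ltnNge size_poly.
have [r /dvdpP[q def_r]] := mod_primary_socle pi_irr dv.
have := moments0 r (orbitU a) a0; rewrite -pevalM mulrC.
rewrite -(subrK (pi ^+ k.-1) (_ * r)) def_r pevalD pevalM mU // linear0 add0r.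
by move/eqP; apply/negP.
Qed.

Let hankel_sym : hankel^T = hankel.
Proof. by apply/matrixP=> i j; rewrite !mxE addnC. Qed.

Let hankel_unit : hankel \in unitmx.
Proof.
rewrite -row_free_unit; apply: inj_row_free => a a0.
by apply: orbit_inj; rewrite moments_orbit.
Qed.

(** [U1] is the cyclic subspace generated by [x] and [U2] is the set of vectors
    of [U] with zero moments.  The form on [U1] sends [p(A) x] and [q(A) x] to
    [phi ((p * q)(A) x)], which is visibly symmetric and for which [A] is
    self-adjoint; the inverse Hankel matrix extends it to all of [V]. *)
Lemma hankel_split : exists U1 U2 : {vspace V},
  [/\ [/\ (A @: U1 <= U1)%VS, (A @: U2 <= U2)%VS, (U1 :&: U2 = 0)%VS
         & (U1 + U2)%VS = U],
      (\dim U2 < \dim U)%N & symmetrizable_on A U1].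
Proof.
pose lorb := GRing.isLinear.Build _ _ _ _ orbit orbit_lin.
pose orbL : {linear _ -> _} := HB.pack orbit lorb.
pose lmom := GRing.isLinear.Build _ _ _ _ moments moments_lin.
pose momL : {linear _ -> _} := HB.pack moments lmom.
pose E := linfun orbL; pose H := linfun momL.
have EE a : E a = orbit a by rewrite lfunE.
have HE y : H y = moments y by rewrite lfunE.
exists (limg E), (U :&: lker H)%VS; split; first split.
- apply/subvP => _ /memv_imgP[_ /memv_imgP[a _ ->] ->].
  rewrite EE -peval_comm -{1}pevalX -pevalM mulrC.
  rewrite -(peval_mod _ (mU xU)) -(poly_rV_K (size_mod _)) -/(orbit _) -EE.
  exact/memv_img/memvf.
- apply/subvP => _ /memv_imgP[y yUH ->].
  have /memv_capP[yU] := yUH; rewrite memv_ker HE => /eqP y0.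
  rewrite memv_cap (subvP stU) ?memv_img //= memv_ker HE; apply/eqP/rowP=> i.
  by rewrite !mxE -pevalX -pevalM moments0.
- apply/eqP; rewrite -subv0; apply/subvP => _ /memv_capP[/memv_imgP[a _ ->]].
  rewrite memv_cap memv_ker HE EE => /andP[_ /eqP/orbit_inj->].
  by rewrite -EE linear0 mem0v.
- apply/eqP; rewrite eqEsubv subv_add capvSl andbT; apply/andP; split.
    by apply/subvP => _ /memv_imgP[a _ ->]; rewrite EE.
  (* The component of y in the cyclic subspace is the one with the same moments. *)
  apply/subvP => y yU; pose a := moments y *m invmx hankel.
  rewrite -(subrKC (E a) y) memv_add ?memv_img ?memvf //.
  rewrite memv_cap memvB ?EE //= memv_ker linearB /= !HE moments_orbit.
  by rewrite mulmxKV // subrr.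
- rewrite ltn_neqAle dimvS ?capvSl // andbT.
  apply/negP=> /eqP eqd; have /eqP eqU : (U :&: lker H)%VS == U.
    by rewrite eqEdim capvSl eqd /=.
  move: xU; rewrite -eqU memv_cap memv_ker HE => /andP[_ /eqP x0].
  by move/eqP: phix; apply; apply: moments0.
pose f y z := (moments y *m invmx hankel *m (moments z)^T) 0 0.
have f_orbit a z : f (orbit a) z = phi (peval (rVpoly a) z).
  rewrite /f moments_orbit mulmxK // phi_rVpoly mxE.
  by apply: eq_bigr=> i _; rewrite !mxE.
exists f; split.
- by move=> y a z t; rewrite /f moments_lin linearP /= mulmxDr -scalemxAr !mxE.
- move=> y z; rewrite /f -[in LHS](trmxK (_ *m _ *m _)) [LHS]mxE.
  by rewrite !trmx_mul trmxK trmx_inv hankel_sym mulmxA.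
- move=> _ z /memv_imgP[a _ ->] /memv_imgP[c _ def_z].
  have zU : z \in U by rewrite def_z EE.
  rewrite EE f_orbit -peval_comm -{1}pevalX -pevalM mulrC.
  rewrite -(peval_mod _ (mU xU)) -(poly_rV_K (size_mod _)) -/(orbit _) f_orbit.
  by rewrite poly_rV_K // peval_mod ?mU // pevalM pevalX peval_comm.
move=> _ /memv_imgP[a _ ->]; rewrite [E _]EE => fa0.
have /orbit_inj-> : moments (orbit a) = 0; last by rewrite -EE linear0.
apply/rowP=> i; have := fa0 (E (delta_mx 0 i)) (memv_img _ (memvf _)).
by rewrite [E _]EE f_orbit pevalC rVpoly_delta !mxE.
Qed.

End Hankel.

(** * The Taussky-Zassenhaus theorem *)

(** When [k] is the least exponent for which [pi ^+ k] annihilates [U], some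
    vector [x] survives [pi ^+ k.-1], and the cyclic subspace that it generates
    can be split off. *)
Lemma primary_symmetrizable (pi : {poly F}) k U :
    irreducible_poly pi -> (A @: U <= U)%VS ->
    {in U, forall y, peval (pi ^+ k) y = 0} ->
  symmetrizable_on A U.
Proof.
move=> pi_irr; elim: {U}_.+1 {-2}U (ltnSn (\dim U)) k => // n IHn U le_Un k stU.
elim: k => [|k IHk] kU.
  suff ->: U = 0%VS by apply: symmetrizable0.
  by apply/eqP; rewrite -subv0; apply/subvP=> y /kU; rewrite peval1 memv0 => ->.
have [kerU|/subvPn[x xU]] := boolP (U <= lker (peval (pi ^+ k)))%VS.
  by apply: IHk => y /(subvP kerU); rewrite memv_ker => /eqP.
rewrite memv_ker => /exists_functional[phi phix].
have [U1 [U2 [[st1 st2 dx12 defU] lt_U2 sym1]]] :=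
  hankel_split pi_irr stU kU xU phix.
apply: (symmetrizable_direct_sum st1 st2 dx12 defU sym1).
apply: (IHn _ _ k.+1) => // [|y yU2]; first exact: leq_trans lt_U2 le_Un.
by apply: kU; rewrite -defU (subvP (addvSr _ _)).
Qed.

Lemma annihilated_symmetrizable (p : {poly F}) U : p != 0 -> (A @: U <= U)%VS ->
  {in U, forall y, peval p y = 0} -> symmetrizable_on A U.
Proof.
elim: {p}_.+1 {-2}p (ltnSn (size p)) U => // n IHn p le_pn U p0 stU pU.
have [p_gt1|p_le1] := ltnP 1 (size p); last first.
  have [c c0 def_p] : exists2 c, c != 0 & p = c *: 1.
    exists p`_0; last by rewrite -mul_polyC mulr1 -size1_polyC.
    by apply: contraNneq p0 => c0; rewrite (size1_polyC p_le1) c0.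
  suff ->: U = 0%VS by apply: symmetrizable0.
  apply/eqP; rewrite -subv0; apply/subvP=> y /pU/eqP.
  by rewrite def_p pevalZ peval1 scaler_eq0 (negPf c0) memv0.
have [pi pi_irr pi_p] := irreducible_factor p_gt1.
have pi_gt1 : (1 < size pi)%N by case: pi_irr.
have [k [m [def_p pi_m]]] := split_power pi_gt1 p0.
have cop : coprimep (pi ^+ k) m by rewrite coprimep_expl ?irreducible_poly_coprime.
have /Bezout_eq1_coprimepP[[u v] /= uv1] := cop.
have m0 : m != 0 by apply: contraNneq p0 => m0; rewrite def_p m0 mulr0.
have pk0 : pi ^+ k != 0 by rewrite expf_neq0 ?irredp_neq0.
have lt_mp : (size m < size p)%N.
  have k_gt0 : (0 < k)%N.
    by rewrite lt0n; apply: contraNneq pi_m => k0; rewrite def_p k0 mul1r in pi_p.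
  have pk_gt1 : (1 < size (pi ^+ k))%N.
    rewrite ltnNge; apply/negP=> pk_le1; move: pi_gt1; rewrite ltnNge.
    by rewrite (leq_trans _ pk_le1) // dvdp_leq // -[X in X %| _]expr1 dvdp_exp2l.
  rewrite def_p size_mul //; case: (size (pi ^+ k)) pk_gt1 => [|[|j]] // _.
  by rewrite !addSn /= ltnS leq_addl.
pose U1 := (U :&: lker (peval (pi ^+ k)))%VS; pose U2 := (U :&: lker (peval m))%VS.
have stK q : (A @: (U :&: lker (peval q)) <= U :&: lker (peval q))%VS.
  apply/subvP => _ /memv_imgP[y yUq ->].
  have /memv_capP[yU] := yUq; rewrite memv_ker => /eqP y0.
  rewrite memv_cap memv_ker (subvP stU) ?memv_img //=.
  by rewrite peval_comm y0 linear0.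
have K0 q y : y \in (U :&: lker (peval q))%VS -> peval q y = 0.
  by rewrite memv_cap memv_ker => /andP[_ /eqP].
have split_y y : y = peval (u * pi ^+ k) y + peval (v * m) y.
  by rewrite -pevalD uv1 peval1.
apply: (@symmetrizable_direct_sum A U U1 U2); rewrite ?stK //.
- apply/eqP; rewrite -subv0; apply/subvP => y /memv_capP[/K0 y1 /K0 y2].
  by rewrite (split_y y) !pevalM y1 y2 !linear0 addr0 mem0v.
- apply/eqP; rewrite eqEsubv subv_add !capvSl; apply/subvP => y yU.
  have pevalU q : peval q y \in U.
    by apply/(subvP (peval_stable q stU))/memv_img.
  rewrite (split_y y) addrC memv_add // memv_cap pevalU memv_ker -pevalM; apply/eqP.
    by rewrite mulrCA -def_p pevalM pU // linear0.
  by rewrite mulrCA [m * _]mulrC -def_p pevalM pU // linear0.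
- by apply: (@primary_symmetrizable pi k) ; [exact: pi_irr | exact: stK | move=> y /K0].
apply: (IHn m); [exact: leq_trans lt_mp le_pn | exact: m0 | exact: stK |].
by move=> y /K0.
Qed.

End Eval.

(** The Taussky-Zassenhaus theorem, for the restriction of [A] to [U]. *)
Theorem stable_symmetrizable A U : (A @: U <= U)%VS -> symmetrizable_on A U.
Proof.
move=> stU; case: (posnP (dim V)) => [V0|V_proper].
  suff ->: U = 0%VS by apply: symmetrizable0.
  by apply/eqP; rewrite -dimv_eq0 -leqn0 -V0 -dimvf dimvS ?subvf.
have [p p0 pA0] := annihilating_poly V_proper A.
exact: (@annihilated_symmetrizable V_proper A p).
Qed.
End SelfAdjoint.

(** * Bilinear forms against a symplectic form *)

Section Symplectic.
Variables (F : fieldType) (V : vectType F) (b : {skew_symmetric V}).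
Hypotheses (char_neq2 : 2%N \notin [pchar F]) (ndeg_b : nondegenerate b).
Implicit Types (L M N U : {vspace V}) (u v : 'End(V)).

Let formDl x y z : b (x + y) z = b x z + b y z. Proof. exact: linearDl. Qed.
Let formDr x y z : b x (y + z) = b x y + b x z. Proof. exact: linearDr. Qed.
Let formNr x y : b x (- y) = - b x y. Proof. exact: linearNr. Qed.
Let formBr x y z : b x (y - z) = b x y - b x z. Proof. exact: linearBr. Qed.
Let formZl a x y : b (a *: x) y = a * b x y. Proof. exact: linearZl_LR. Qed.
Let formZr a x y : b x (a *: y) = a * b x y. Proof. exact: linearZr_LR. Qed.

Lemma skewE x y : b x y = - b y x.
Proof. by rewrite hermC /= expr1 mulN1r. Qed.

Lemma skew_diag x : b x x = 0.
Proof.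
have /eqP : b x x + b x x = 0 by rewrite {1}skewE addNr.
rewrite -mulr2n -mulr_natl mulf_eq0 => /orP[two0|/eqP//].
by case/negP: char_neq2; rewrite inE.
Qed.

Lemma nondegenerateP z : (forall x, b x z = 0) -> z = 0.
Proof.
move=> bz0; apply/eqP; rewrite -memv0 -(eqP ndeg_b).
by apply/mem_orthovP=> x _; rewrite skewE bz0 oppr0.
Qed.

(** Nondegeneracy makes [y |-> b _ y] an isomorphism onto the dual space, so any
    other bilinear form factors through it. *)
Lemma representation (f : V -> V -> F) :
    (forall x, scalar (f x)) -> (forall y, scalar (f^~ y)) ->
  exists g : 'End(V), forall x y, b x (g y) = f x y.
Proof.
move=> lin_r lin_l.
pose dual (h : V -> V -> F) (lin : forall y, scalar (h^~ y)) y : 'Hom(V, F^o) :=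
  linfun (HB.pack (fun x => h x y : F^o)
    (GRing.isLinear.Build F V F^o _ (fun x => h x y) (lin y)) : {linear V -> F^o}).
have dualE h lin y x : dual h lin y x = h x y by rewrite lfunE.
have dual_lin h lin : (forall x, scalar (h x)) -> linear (dual h lin).
  move=> lr a y z; apply/lfunP=> x.
  by rewrite add_lfunE scale_lfunE !dualE lr.
have b_l y : scalar (b^~ y) by move=> a x z; rewrite formDl formZl.
have b_r x : scalar (b x) by move=> a y z; rewrite formDr formZr.
pose toHom h l r := linfun (HB.pack (dual h l)
  (GRing.isLinear.Build F V _ _ (dual h l) (dual_lin h l r)) : {linear V -> 'Hom(V, F^o)}).
have toHomE h l r y x : toHom h l r y x = h x y by rewrite lfunE /= dualE.
pose bV := toHom _ b_l b_r; pose fV := toHom _ lin_l lin_r.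
have kerb : lker bV == 0%VS.
  rewrite -subv0; apply/subvP=> z; rewrite memv_ker memv0 => /eqP bz0; apply/eqP.
  by apply: nondegenerateP => x; rewrite -(toHomE _ b_l b_r) [toHom _ _ _ _]bz0 lfunE.
have imb : limg bV = fullv.
  apply/eqP; rewrite eqEdim subvf limg_dim_eq; last by rewrite (eqP kerb) capv0.
  by rewrite !dimvf /dim /= muln1.
exists (bV^-1 \o fV)%VF => x y.
by rewrite comp_lfunE -(toHomE _ b_l b_r) limg_lfunVK ?imb ?memvf // toHomE.
Qed.

(** This is the inclusion of the double orthogonal of [U] in [U]: a functional
    that vanishes on [U] but not at [w] is represented by a vector [z]. *)
Lemma orthov_separates U w :
  w \notin U -> exists2 z, z \in orthov b U & b z w != 0.
Proof.
move=> wU; have /exists_functional[phi phiw] : w - projv U w != 0.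
  by apply: contraNneq wU => /subr0_eq->; apply: memv_proj.
(* A rank one form, with x and y both projected along U: the vector that
   represents f at w is orthogonal to U but not to w. *)
pose f (x y : V) := phi (x - projv U x) * phi (y - projv U y).
have lin y : scalar (f^~ y).
  move=> a x z; rewrite /f linearP /= opprD addrACA -scalerBr linearP /=.
  by rewrite mulrDl mulrA.
have fC x y : f x y = f y x by rewrite /f mulrC.
have [|//|g gE] := @representation f.
  by move=> x a y z; rewrite fC lin !(fC x).
exists (g w); last by rewrite skewE gE oppr_eq0 mulf_neq0.
apply/mem_orthovP=> y yU; rewrite skewE gE /f projv_id // subrr linear0.
by rewrite mul0r oppr0.
Qed.

(** * Lagrangian subspaces *)

Definition lagrangian L := orthov b L == L.

Lemma lagrangianP L : lagrangian L ->
  forall x, reflect {in L, forall y, b x y = 0} (x \in L).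
Proof. by move=> /eqP {2}<- x; apply: mem_orthovP. Qed.

(** Isotropic subspaces are enlarged one line at a time, as every vector is
    orthogonal to itself, and the dimension bounds the process. *)
Lemma maximal_isotropic (P : {vspace V} -> Prop) : P 0%VS ->
  exists N, [/\ {in N &, forall x y, b x y = 0}, P N
    & {in orthov b N, forall x, P (N + <[x]>)%VS -> x \in N}].
Proof.
move=> P0.
suff grow k N : (dim V - \dim N < k)%N -> P N ->
    {in N &, forall x y, b x y = 0} -> exists N', [/\
      {in N' &, forall x y, b x y = 0}, P N' &
      {in orthov b N', forall x, P (N' + <[x]>)%VS -> x \in N'}].
  apply: (grow _ 0%VS (ltnSn _) P0) => x y.
  by rewrite memv0 => /eqP->; rewrite linear0l.
elim: k N => // k IHk N le_k PN isoN; apply: NNPP => noN; case: (noN).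
exists N; split=> // x /mem_orthovP xN PNx; apply/idPn => notNx; apply: noN.
apply: (IHk (N + <[x]>)%VS) => //.
  have lt_dim : (\dim N < \dim (N + <[x]>))%N.
    rewrite ltn_neqAle dimvS ?addvSl // andbT; apply: contraNneq notNx => eq_dim.
    have /eqP-> : N == (N + <[x]>)%VS by rewrite eqEdim addvSl eq_dim /=.
    by rewrite (subvP (addvSr _ _)) ?memv_line.
  rewrite -ltnS; apply: leq_trans le_k; rewrite ltnS ltn_sub2l //.
  by apply: leq_trans lt_dim _; rewrite -dimvf dimvS ?subvf.
move=> _ _ /memv_addP[y yN [_ /vlineP[s ->] ->]] /memv_addP[z zN [_ /vlineP[t ->] ->]].
rewrite !formDl !formDr !formZl !formZr /= isoN // skew_diag xN //.
by rewrite skewE xN // oppr0 !mulr0 !addr0.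
Qed.

Lemma exists_lagrangian : exists L, lagrangian L.
Proof.
have [L [isoL _ maxL]] := @maximal_isotropic (fun=> True) I.
exists L; rewrite /lagrangian eqEsubv; apply/andP; split.
  by apply/subvP=> x xL; apply: maxL.
by apply/subvP=> x xL; apply/mem_orthovP=> y; apply: isoL.
Qed.

(** Only two subspaces have to be avoided, so this holds over finite fields
    too: if neither witness is outside both, their sum is. *)
Lemma sub_not_union U U1 U2 : ~~ (U <= U1)%VS -> ~~ (U <= U2)%VS ->
  exists x, [/\ x \in U, x \notin U1 & x \notin U2].
Proof.
move=> /subvPn[x xU x1] /subvPn[y yU y2].
have [x2|] := boolP (x \in U2); last by exists x.
have [y1|] := boolP (y \in U1); last by exists y.
by exists (x + y); rewrite memvD // rpredDr // rpredDl.
Qed.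

(** Let [N] be maximal among the isotropic subspaces that meet [L] and [M]
    trivially.  If [N] were not Lagrangian, neither [N + L] nor [N + M] would
    contain the orthogonal of [N], so some vector orthogonal to [N] would lie
    outside both, and adding it to [N] would contradict maximality. *)
Lemma lagrangian_transversal L M : lagrangian L -> lagrangian M ->
  exists N, [/\ lagrangian N, (N :&: L = 0)%VS & (N :&: M = 0)%VS].
Proof.
move=> lagL lagM.
have [|N [isoN [NL NM] maxN]] :=
  @maximal_isotropic (fun N => (N :&: L = 0)%VS /\ (N :&: M = 0)%VS).
  by rewrite !cap0v.
exists N; split=> //; rewrite /lagrangian eqEsubv andbC.
have sNN : (N <= orthov b N)%VS.
  by apply/subvP=> x xN; apply/mem_orthovP=> y; apply: isoN.
rewrite sNN /=; apply/idPn=> notNN.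
(* If N + K contains the orthogonal of N, then a vector of K orthogonal to N
   is orthogonal to N + K, hence to the orthogonal of N, so it lies in N and
   vanishes; it follows that the orthogonal of N is contained in N. *)
have key K : lagrangian K -> (N :&: K = 0)%VS -> ~~ (orthov b N <= N + K)%VS.
  move=> lagK NK; apply: contraNN notNN => sNK.
  have ortho0 x : x \in orthov b N -> x \in K -> x = 0.
    move=> /mem_orthovP xN xK; apply/eqP; rewrite -memv0 -NK memv_cap xK andbT.
    apply/idPn=> /orthov_separates[z /(subvP sNK)/memv_addP[y yN [k kK ->]]].
    rewrite formDl /= skewE xN // oppr0 add0r.
    by have /(lagrangianP lagK)-> := kK; rewrite ?eqxx.
  apply/subvP=> y yN; have /memv_addP[x xN [k kK def_y]] := subvP sNK y yN.
  rewrite def_y (ortho0 k) ?addr0 //.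
  by rewrite -(addKr x k) -def_y memvD ?memvN // (subvP sNN).
have [x [xN xL xM]] := sub_not_union (key L lagL NL) (key M lagM NM).
have ext K : (N :&: K = 0)%VS -> x \notin (N + K)%VS -> ((N + <[x]>) :&: K = 0)%VS.
  move=> NK xK; apply/eqP; rewrite -subv0; apply/subvP=> z /memv_capP[].
  move=> /memv_addP[y yN [_ /vlineP[t ->] ->]] ytK {z}.
  have [t0|t0] := eqVneq t 0.
    by move: ytK; rewrite t0 scale0r addr0 -NK memv_cap yN.
  case/negP: xK; rewrite -[x](scalerK t0) memvZ // -(addKr y (t *: x)).
  by rewrite memv_add ?memvN.
have NxN : x \in N by apply: maxN => //; split; apply: ext.
by case/negP: xL; rewrite (subvP (addvSl _ _)).
Qed.

(** * Isometries *)

Lemma isometry_ker0 u : isometry b b u -> lker u == 0%VS.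
Proof.
move=> iso_u; rewrite -subv0; apply/subvP=> y; rewrite memv_ker memv0 => /eqP uy0.
by apply/eqP/nondegenerateP => x; rewrite -iso_u uy0 linear0r.
Qed.

Lemma isometry_in_Sp u : isometry b b u -> in_Sp b u.
Proof.
move=> iso_u; split=> //; exists (u^-1)%VF.
  exact/lker0_lfunK/isometry_ker0.
exact/lker0_lfunVK/isometry_ker0.
Qed.

Lemma lagrangian_img u L : isometry b b u -> lagrangian L -> lagrangian (u @: L)%VS.
Proof.
move=> iso_u lagL; have ker0 := isometry_ker0 iso_u.
rewrite /lagrangian eqEsubv; apply/andP; split; apply/subvP=> x.
  rewrite -[x](lker0_lfunVK ker0) => /mem_orthovP xL.
  apply/memv_img/(lagrangianP lagL) => y yL.
  by rewrite -iso_u xL ?memv_img.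
move=> /memv_imgP[y yL ->]; apply/mem_orthovP => _ /memv_imgP[z zL ->].
by rewrite iso_u; have /(lagrangianP lagL)-> := yL.
Qed.

Lemma lagrangian_sum L N : lagrangian L -> lagrangian N -> (L :&: N = 0)%VS ->
  (L + N)%VS = fullv.
Proof.
move=> lagL lagN LN; apply/eqP; rewrite eqEsubv subvf; apply/subvP=> w _.
apply/idPn => /orthov_separates[z /mem_orthovP zLN]; suff -> : z = 0.
  by rewrite linear0l eqxx.
apply/eqP; rewrite -memv0 -LN memv_cap; apply/andP.
split; [apply/(lagrangianP lagL)|apply/(lagrangianP lagN)] => y yL; apply: zLN.
  by rewrite (subvP (addvSl _ _)).
by rewrite (subvP (addvSr _ _)).
Qed.

(** * Unipotents of index 2 *)

(** The condition on [n] says that [n] lies in the symplectic Lie algebra; with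
    [n ^ 2 = 0], the unipotent [1 + n] is its exponential. *)
Lemma U2_of_square_zero (n : 'End(V)) : (forall x, n (n x) = 0) ->
  (forall x y, b x (n y) = b y (n x)) -> U2_element b (\1 + n)%VF.
Proof.
move=> n2 bn; split; last first.
  apply/lfunP=> x; rewrite addrC addKr.
  by rewrite comp_lfunE n2 lfunE.
apply: isometry_in_Sp => x y; rewrite !add_lfunE !id_lfunE !formDl !formDr /=.
by rewrite (bn (n x) y) n2 linear0r (skewE (n x)) -bn; ring.
Qed.

Lemma U2_opp (n : 'End(V)) : (forall x, n (n x) = 0) ->
  (forall x y, b x (n y) = b y (n x)) -> U2_element b (\1 - n)%VF.
Proof.
move=> n2 bn; apply: U2_of_square_zero => [x|x y].
  by rewrite !opp_lfunE linearN /= n2 !oppr0.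
by rewrite !opp_lfunE !formNr /= bn.
Qed.

(** With [w = v + v^-1], the symmetry on [L] says that [w] maps [L] to itself.
    Write [v = (1 - m) c] where [m] kills [L] and takes values in [L].  For
    [x] in [L] one has [c^-1 x = v^-1 x], so [c] can satisfy [c + c^-1 = 2] only
    if [m (v x) = 2 x - w x], and this defines [m] since [V] is the sum of [L]
    and [v L].  The identity [c + c^-1 = 2], which holds on [L] by construction,
    extends to [L + c L = V] because its two sides commute with [c]. *)
Lemma product_of_two_U2 v L : isometry b b v -> lagrangian L ->
    {in L &, forall x y, b x (v y) = b y (v x)} -> (L :&: v @: L = 0)%VS ->
  exists a c, [/\ U2_element b a, U2_element b c & v = (a \o c)%VF].
Proof.
move=> iso_v lagL symL LvL; have ker0 := isometry_ker0 iso_v.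
have vK := lker0_lfunK ker0; have vVK := lker0_lfunVK ker0.
have isoL x y : x \in L -> y \in L -> b x y = 0.
  by move=> xL yL; have /(lagrangianP lagL)-> := xL.
have bV x y : b (v^-1%VF x) y = b x (v y) by rewrite -iso_v vVK.
have bVr x y : b x (v^-1%VF y) = b (v x) y by rewrite skewE bV -skewE.
pose w x := v x + v^-1%VF x.
have wL x : x \in L -> w x \in L.
  move=> xL; apply/(lagrangianP lagL) => y yL.
  by rewrite skewE formDr /= bVr symL // (skewE (v y)) subrr oppr0.
pose p := daddv_pi (v @: L) L.
have vLL : (v @: L :&: L = 0)%VS by rewrite capvC.
have pL x : x \in L -> p x = 0.
  move=> xL; have := daddv_pi_add vLL (subvP (addvSr _ _) x xL).
  by rewrite (daddv_pi_id LvL) // -[RHS]add0r => /addIr.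
have pv x : x \in L -> p (v x) = v x.
  by move=> xL; apply: daddv_pi_id; rewrite ?memv_img.
have decomp y : exists l x, [/\ l \in L, x \in L & y = l + v x].
  have := memvf y; rewrite -(lagrangian_sum lagL (lagrangian_img iso_v lagL) LvL).
  by move=> /memv_addP[l lL [_ /memv_imgP[x xL ->] ->]]; exists l, x.
pose m := ((2%:R *: \1 - v - v^-1%VF)%R \o (v^-1 \o p))%VF.
have mL x : x \in L -> m x = 0.
  by move=> xL; rewrite comp_lfunE comp_lfunE pL // !linear0.
have mv x : x \in L -> m (v x) = 2%:R *: x - w x.
  move=> xL; rewrite comp_lfunE comp_lfunE pv // vK !add_lfunE !opp_lfunE.
  by rewrite scale_lfunE id_lfunE -addrA -opprD.
have m_in y : m y \in L.
  have [l [x [lL xL ->]]] := decomp y.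
  by rewrite linearD /= mL // add0r mv // memvB ?memvZ ?wL.
have m2 y : m (m y) = 0 by rewrite mL.
(* Both terms of the formula for b y (m z) are symmetric in x and x': the first
   by the symmetry on L, the second by that symmetry applied to w x and x'. *)
have bm y z : b y (m z) = b z (m y).
  have red y' z' l x l' x' : l \in L -> x \in L -> l' \in L -> x' \in L ->
      y' = l + v x -> z' = l' + v x' ->
      b y' (m z') = - 2%:R * b x' (v x) - b (v x) (v^-1%VF x').
    move=> lL xL lL' xL' -> ->; rewrite (linearD m) /= (mL l') // add0r mv //.
    rewrite formDl isoL ?add0r ?memvB ?memvZ ?wL //.
    rewrite formBr formZr /w formDr /= iso_v (isoL x x') // add0r.
    by rewrite (skewE (v x) x') mulrN mulNr.
  have [l [x [lL xL def_y]]] := decomp y; have [l' [x' [lL' xL' def_z]]] := decomp z.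
  rewrite (red _ _ l x l' x') // (red _ _ l' x' l x) // symL //; congr (_ - _).
  have wE t : v^-1%VF t = w t - v t by rewrite /w addrAC subrr add0r.
  rewrite [in RHS]wE formBr iso_v (isoL x' x) // subr0.
  rewrite [RHS]skewE (symL (w x) x') ?wL // /w linearD /= vVK formDr.
  by rewrite (isoL x' x) // addr0 -bV -skewE.
pose a := (\1 - m)%VF; pose c := ((\1 + m) \o v)%VF.
have aE y : a y = y - m y by rewrite add_lfunE opp_lfunE id_lfunE.
have cE y : c y = v y + m (v y) by rewrite comp_lfunE add_lfunE id_lfunE.
exists a, c; split; first exact: U2_opp; last first.
  apply/lfunP=> y; rewrite comp_lfunE aE cE linearD /= m2 addr0.
  by rewrite addrK.
have [[_ iso_m] _] := U2_of_square_zero m2 bm.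
split.
  by apply: isometry_in_Sp => x y; rewrite ![c _]comp_lfunE iso_m iso_v.
have cL x : x \in L -> c x = 2%:R *: x - v^-1%VF x.
  by move=> xL; rewrite cE mv // /w opprD addrCA addNKr.
have ccL x : x \in L -> c (c x) = 2%:R *: c x - x.
  move=> xL; rewrite {1}(cL x xL) linearB linearZ /=; congr (_ - _).
  by rewrite cE vVK mL // addr0.
have decompc y : exists l x, [/\ l \in L, x \in L & y = l + c x].
  have [l [x [lL xL ->]]] := decomp y; exists (l - m (v x)), x.
  by rewrite cE addrACA addNr addr0 memvB.
pose e := c - \1%VF; have eE z : e z = c z - z.
  by rewrite add_lfunE opp_lfunE id_lfunE.
have ec z : e (c z) = c (e z) by rewrite !eE linearB.
have e2 z : z \in L -> e (e z) = 0.
  move=> zL; rewrite (eE (e z)) eE linearB /= ccL // scaler_nat mulr2n.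
  by rewrite (addrAC _ (- z)) addrK subrr.
apply/lfunP=> y; have [l [x [lL xL ->]]] := decompc y.
rewrite zero_lfunE comp_lfunE -/e (linearD e) /= (linearD e) /= e2 //.
by rewrite ec ec e2 // linear0 addr0.
Qed.

(** The correction [1 + n] turns [u] into an isometry [v] with
    [b x (v y) = f x (A y)] on [L], where [f] is a form for which [A] is
    self-adjoint. *)
Lemma product_of_three_U2 u : isometry b b u ->
  exists u1 u2 u3 : 'End(V),
    [/\ U2_element b u1, U2_element b u2, U2_element b u3
      & u = (u1 \o u2 \o u3)%VF].
Proof.
move=> iso_u; have [L lagL] := exists_lagrangian.
have lagM := lagrangian_img iso_u lagL.
have [N [lagN NL NM]] := lagrangian_transversal lagL lagM.
have LN : (L :&: N = 0)%VS by rewrite capvC.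
have isoL x y : x \in L -> y \in L -> b x y = 0.
  by move=> xL yL; have /(lagrangianP lagL)-> := xL.
have isoN x y : x \in N -> y \in N -> b x y = 0.
  by move=> xN yN; have /(lagrangianP lagN)-> := xN.
pose pL := daddv_pi L N; pose pN := daddv_pi N L.
have pL_in y : pL y \in L by apply: memv_pi.
have pN_in y : pN y \in N by apply: memv_pi.
have pD y : pL y + pN y = y.
  by apply: daddv_pi_add; rewrite ?lagrangian_sum ?memvf.
have pL_id y : y \in L -> pL y = y by apply: daddv_pi_id.
have pN_id y : y \in N -> pN y = y by apply: daddv_pi_id.
have pL_0 y : y \in N -> pL y = 0.
  by move=> yN; apply: (addIr (pN y)); rewrite pD pN_id ?add0r.
have pN_0 y : y \in L -> pN y = 0.
  by move=> yL; apply: (addrI (pL y)); rewrite pD pL_id ?addr0.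
(* On L this is u followed by the projection along N; the identity on N makes
   it an automorphism of V that can be inverted. *)
pose A := (pL \o u \o pL + pN)%VF.
have AE y : A y = pL (u (pL y)) + pN y by rewrite add_lfunE !comp_lfunE.
have AL x : x \in L -> A x = pL (u x).
  by move=> xL; rewrite AE (pL_id x) // pN_0 ?addr0.
have kerA : lker A == 0%VS.
  rewrite -subv0; apply/subvP=> y; rewrite memv_ker memv0 => /eqP Ay0.
  have y_N : pN y = 0.
    have := congr1 pN Ay0; rewrite AE linearD /= linear0.
    by rewrite (pN_0 (pL _)) // add0r pN_id.
  have uy : u (pL y) \in (N :&: u @: L)%VS.
    move: Ay0; rewrite AE y_N addr0 => uy0.
    by rewrite memv_cap memv_img // andbT -(pD (u _)) uy0 add0r.
  move: uy; rewrite NM memv0 => /eqP uy0.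
  rewrite -(pD y) y_N addr0 -memv0 -(eqP (isometry_ker0 iso_u)) memv_ker.
  exact/eqP.
have AK := lker0_lfunK kerA; have AVK := lker0_lfunVK kerA.
have AVL y : y \in L -> A^-1%VF y \in L.
  move=> yL; set z := A^-1%VF y; have := congr1 pN (AVK y).
  rewrite -/z AE linearD /= (pN_0 (pL _)) // add0r (pN_id (pN z)) // (pN_0 y) // => z0.
  by rewrite -(pD z) z0 addr0.
have stL : (A @: L <= L)%VS.
  by apply/subvP=> _ /memv_imgP[x xL ->]; rewrite AL.
have [f [lin_f sym_f adj_f ndeg_f]] := stable_symmetrizable stL.
have bL x y : x \in L -> b x y = b x (pN y).
  by move=> xL; rewrite -{1}(pD y) formDr isoL // add0r.
have bN x y : x \in N -> b x y = b x (pL y).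
  by move=> xN; rewrite -{1}(pD y) formDr addrC isoN // add0r.
pose r x y := b x (u (A^-1%VF y)).
(* As u x' and u y' are orthogonal, b (A x') (u y') = b (A y') (u x') once each
   vector is split along L and N. *)
have sym_r x y : x \in L -> y \in L -> r x y = r y x.
  move=> /AVL; rewrite /r -{2 3}(AVK x); set x' := A^-1%VF x => xL.
  move=> /AVL; rewrite -{2 3}(AVK y); set y' := A^-1%VF y => yL.
  rewrite !AK !AL //.
  have := isoL _ _ xL yL; rewrite -iso_u -{1}(pD (u x')) formDl.
  move/eqP; rewrite addr_eq0 => /eqP ->.
  by rewrite [in LHS]bN // -(skewE (pL _)) [in RHS]bL.
pose q x y := f (pL x) (pL y) - r (pL x) (pL y).
have sym_q x y : q x y = q y x by rewrite /q sym_f sym_r.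
have lin_q x : scalar (q x).
  by move=> a y z; rewrite /q /r !linearP lin_f /= opprD addrACA mulrBr.
have [//||n nE] := @representation q.
  by move=> x a y z; rewrite /= !(sym_q _ x) lin_q.
have q0 x y : y \in N -> q x y = 0.
  move=> yN; rewrite /q /r (pL_0 y) // !linear0 subr0.
  by have := lin_f (pL x) (-1) 0 0; rewrite scaler0 addr0 mulN1r addNr.
have n_N y : y \in N -> n y = 0.
  by move=> yN; apply: nondegenerateP => x; rewrite nE q0.
have n_in y : n y \in N.
  by apply/(lagrangianP lagN)=> x xN; rewrite skewE nE sym_q q0 // oppr0.
have n2 y : n (n y) = 0 by rewrite n_N.
have bn x y : b x (n y) = b y (n x) by rewrite !nE.
have [[_ iso_n] _] := U2_of_square_zero n2 bn.
pose v := ((\1 + n) \o u)%VF.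
have vE y : v y = u y + n (u y) by rewrite comp_lfunE add_lfunE id_lfunE.
have iso_v : isometry b b v by move=> x y; rewrite ![v _]comp_lfunE iso_n iso_u.
have b_v x y : x \in L -> y \in L -> b x (v y) = f x (A y).
  move=> xL yL; rewrite vE formDr nE /q /r pL_id // -(AL y) // AK.
  by rewrite addrC subrK.
have [||a [c [U2a U2c def_v]]] := product_of_two_U2 iso_v lagL.
- by move=> x y xL yL; rewrite !b_v // -adj_f // sym_f.
- apply/eqP; rewrite -subv0; apply/subvP=> z /memv_capP[zL /memv_imgP[x xL def_z]].
  have /(lker0P kerA) x0 : A x = A 0.
    rewrite linear0; apply: ndeg_f => [|y yL]; first by rewrite AL.
    by rewrite sym_f -b_v // -def_z isoL.
  by rewrite def_z x0 linear0 mem0v.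
exists (\1 - n)%VF, a, c; split=> //; first exact: U2_opp.
apply/lfunP=> y; rewrite -comp_lfunA -def_v comp_lfunE vE add_lfunE opp_lfunE id_lfunE.
by rewrite linearD /= n2 addr0 addrK.
Qed.

End Symplectic.

Theorem theorem1p6 (F : fieldType) (char_neq2 : 2%N \notin [pchar F])
    (V : vectType F) (b : {skew_symmetric V}) (ndeg_b : nondegenerate b)
    (u : 'End(V)) (Sp_u : in_Sp b u) :
  exists u1 u2 u3 : 'End(V),
    [/\ U2_element b u1, U2_element b u2, U2_element b u3
      & u = (u1 \o u2 \o u3)%VF].
Proof. exact: product_of_three_U2 (proj2 Sp_u). Qed.
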